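(* Let $\mathfrak{g}$ be a Leibniz algebra and $E$ a vector space containing $\mathfrak{g}$ as a subspace. Then any Leibniz algebra structure on $E$ that contains $\mathfrak{g}$ (with its given bracket) as a two-sided ideal is isomorphic to a crossed product of Leibniz algebras $\mathfrak{g}\#_{\triangleright,\leftharpoonup}^f V$, where $V$ is a complement of $\mathfrak{g}$ in $E$ equipped with some Leibniz algebra structure $\{-,-\}$ and $(\mathfrak{g},V,\triangleright,\leftharpoonup,f)$ is a crossed system, and the isomorphism can be chosen to stabilize $\mathfrak{g}$ and co-stabilize $V$.
   Context: All vector spaces, linear and bilinear maps are over an arbitrary field $k$. A Leibniz algebra is a vector space $\mathfrak{g}$ with a bilinear map $[-,-]$ satisfying $[g,[h,l]]=[[g,h],l]-[[g,l],h]$. A two-sided ideal of a Leibniz algebra $E$ is a subspace $I$ with $[x,e]\in I$ and $[e,x]\in I$ for all $x\in I$, $e\in E$. A complement of $\mathfrak{g}$ in $E$ is a subspace $V$ with $E=\mathfrak{g}+V$, $\mathfrak{g}\cap V=0$. Let $(\mathfrak{g},[-,-])$ and $(V,\{-,-\})$ be Leibniz algebras and $\triangleright:V\times\mathfrak{g}\to\mathfrak{g}$, $\leftharpoonup:\mathfrak{g}\times V\to\mathfrak{g}$, $f:V\times V\to\mathfrak{g}$ bilinear maps. $(\mathfrak{g},V,\triangleright,\leftharpoonup,f)$ is a crossed system of Leibniz algebras if for all $g,h\in\mathfrak{g}$, $x,y,z\in V$: (CS1) $[g,h]\leftharpoonup x=[g,h\leftharpoonup x]+[g\leftharpoonup x,h]$;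 (CS2) $g\leftharpoonup\{x,y\}=(g\leftharpoonup x)\leftharpoonup y-(g\leftharpoonup y)\leftharpoonup x-[g,f(x,y)]$; (CS3) $x\triangleright f(y,z)=f(x,y)\leftharpoonup z-f(x,z)\leftharpoonup y+f(\{x,y\},z)-f(\{x,z\},y)-f(x,\{y,z\})$; (CS4) $x\triangleright[g,h]=[x\triangleright g,h]-[x\triangleright h,g]$; (CS5) $\{x,y\}\triangleright g=x\triangleright(y\triangleright g)+(x\triangleright g)\leftharpoonup y-[f(x,y),g]$; (CS6) $[g,h\leftharpoonup x]+[g,x\triangleright h]=0$; (CS7) $x\triangleright(y\triangleright g)+x\triangleright(g\leftharpoonup y)=0$. The associated crossed product $\mathfrak{g}\#_{\triangleright,\leftharpoonup}^f V$ is the Leibniz algebra $\mathfrak{g}\times V$ with bracket $[(g,x),(h,y)]=([g,h]+x\triangleright h+g\leftharpoonup y+f(x,y),\ \{x,y\})$. A linear map $\varphi:\mathfrak{g}\times V\to E$ stabilizes $\mathfrak{g}$ if $\varphi(g,0)=g$ for all $g\in\mathfrak{g}$, and co-stabilizes $V$ if $\pi(\varphi(g,x))=x$ for all $(g,x)$, where $\pi:E=\mathfrak{g}\oplus V\to V$ is the projection along $\mathfrak{g}$. *)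

(* Defs.v *)
From HB Require Import structures.
From mathcomp Require Import all_boot all_order all_algebra.

Set Implicit Arguments.
Unset Strict Implicit.
Unset Printing Implicit Defensive.

Import GRing.Theory.
Local Open Scope ring_scope.

Definition subsp (k : fieldType) (E : lmodType k) (S : submodClosed E) : Type :=
  {x : E | x \in S}.

HB.instance Definition _ (k : fieldType) (E : lmodType k) (S : submodClosed E) :=
  SubChoice.on (subsp S).
HB.instance Definition _ (k : fieldType) (E : lmodType k) (S : submodClosed E) :=
  [SubChoice_isSubLmodule of subsp S by <:].

Section LeibnizAlgebras.
Variable k : fieldType.

Definition leibniz (L : lmodType k) (br : {bilinear L -> L -> L}) : Prop :=
  forall g h l : L, br g (br h l) = br (br g h) l - br (br g l) h.

Definition leibniz_isomorphism (L M : lmodType k)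
    (brL : {bilinear L -> L -> L}) (brM : {bilinear M -> M -> M})
    (phi : {linear L -> M}) : Prop :=
  bijective phi /\ forall a b : L, phi (brL a b) = brM (phi a) (phi b).

End LeibnizAlgebras.

Section CrossedProducts.
(* tr x g stands for x |> g (V acting on G), lh g x for the right action
   g <- x of V on G, and f for the cocycle. *)
Variables (k : fieldType) (G V : lmodType k).
Variables (brG : {bilinear G -> G -> G}) (brV : {bilinear V -> V -> V}).
Variables (tr : {bilinear V -> G -> G}) (lh : {bilinear G -> V -> G}).
Variable f : {bilinear V -> V -> G}.

Record crossed_system : Prop := CrossedSystem {
  cs_leibnizG : leibniz brG;
  cs_leibnizV : leibniz brV;
  cs1 : forall g h x, lh (brG g h) x = brG g (lh h x) + brG (lh g x) h;
  cs2 : forall g x y,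
    lh g (brV x y) = lh (lh g x) y - lh (lh g y) x - brG g (f x y);
  cs3 : forall x y z,
    tr x (f y z) = lh (f x y) z - lh (f x z) y
                   + f (brV x y) z - f (brV x z) y - f x (brV y z);
  cs4 : forall x g h, tr x (brG g h) = brG (tr x g) h - brG (tr x h) g;
  cs5 : forall x y g,
    tr (brV x y) g = tr x (tr y g) + lh (tr x g) y - brG (f x y) g;
  cs6 : forall g h x, brG g (lh h x) + brG g (tr x h) = 0;
  cs7 : forall x y g, tr x (tr y g) + tr x (lh g y) = 0
}.

Definition crossed_product_bracket (a b : (G * V)%type) : (G * V)%type :=
  (brG a.1 b.1 + tr a.2 b.1 + lh a.1 b.2 + f a.2 b.2, brV a.2 b.2).

Fact crossed_product_bracket_bilinear :
  bilinear_for *:%R *:%R crossed_product_bracket.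
Proof.
by split=> [[g x]|[g x]] c [g1 x1] [g2 x2]; congr (_, _);
  rewrite /= ?linearPl ?linearPr //= !scalerDr;
  do 3! [rewrite [RHS]addrACA; congr (_ + _)].
Qed.

HB.instance Definition _ :=
  bilinear_isBilinear.Build k (G * V)%type (G * V)%type (G * V)%type
    *:%R *:%R crossed_product_bracket crossed_product_bracket_bilinear.

End CrossedProducts.

Section Complements.
Variables (k : fieldType) (E : lmodType k) (S V : submodClosed E).

Definition complement : Prop :=
  (forall e : E, exists (s : subsp S) (v : subsp V), e = val s + val v)
  /\ (forall e : E, e \in S -> e \in V -> e = 0).

Fact complement_ex (SV : complement) (e : E) :
  exists v : subsp V, e - val v \in S.
Proof. by have [s [v ->]] := SV.1 e; exists v; rewrite addrK; apply: valP. Qed.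

(* The projection E = S (+) V -> V along S; its value is characterized by
   complement_projE below, so the use of choice is harmless. *)
Definition complement_proj (SV : complement) (e : E) : subsp V :=
  xchoose (complement_ex SV e).

Lemma complement_projE (SV : complement) (s : subsp S) (v : subsp V) :
  complement_proj SV (val s + val v) = v.
Proof.
have := xchooseP (complement_ex SV (val s + val v)).
rewrite -/(complement_proj SV _); set w := complement_proj _ _ => Sw.
have subB (T : submodClosed E) x y : x \in T -> y \in T -> x - y \in T.
  by move=> Tx Ty; rewrite -scaleN1r rpredD ?rpredZ.
apply/val_inj/esym/subr0_eq/SV.2; last exact: subB (valP v) (valP w).
by have := subB _ _ _ Sw (valP s); rewrite addrAC [_ + val v]addrC addrK.
Qed.

Definition stabilizes (phi : (subsp S * subsp V)%type -> E) : Prop :=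
  forall s : subsp S, phi (s, 0) = val s.

Definition costabilizes (SV : complement)
    (phi : (subsp S * subsp V)%type -> E) : Prop :=
  forall a : (subsp S * subsp V)%type, complement_proj SV (phi a) = a.2.

Definition two_sided_ideal (br : {bilinear E -> E -> E}) : Prop :=
  forall x e : E, x \in S -> (br x e \in S) /\ (br e x \in S).

Definition extends_bracket (brS : {bilinear subsp S -> subsp S -> subsp S})
    (br : {bilinear E -> E -> E}) : Prop :=
  forall x y : subsp S, br (val x) (val y) = val (brS x y).

End Complements.

(* Main.v *)
(** By Zorn's lemma the ideal [g] has a complement.  Given any complement [V],
    the addition map [g * V -> E] is a linear isomorphism, and splitting the
    bracket of [E] along [E = g (+) V] yields [br_V], [tr], [lh] and [f]; since
    [g] is an ideal, the bracket transported to [g * V] is the crossed product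
    bracket.  The crossed system axioms are the components of the Leibniz
    identity of that bracket on triples of pure vectors (with CS6 and CS7 being
    sums of two such identities, in which the last two vectors are swapped). *)
Require Import Defs.
From HB Require Import structures.
From mathcomp Require Import all_boot all_order all_algebra.
From mathcomp Require Import boolp classical_sets.

Set Implicit Arguments.
Unset Strict Implicit.
Unset Printing Implicit Defensive.

Import GRing.Theory.
Local Open Scope ring_scope.

Section ComplementExistence.
Variables (k : fieldType) (E : lmodType k) (S : submodClosed E).
Local Open Scope classical_set_scope.

(* [0 \in A] is not required, so that the union of the empty chain qualifies. *)
Let independent (A : set E) : Prop :=
  (forall c u v, A u -> A v -> A (c *: u + v)) /\
  (forall e, e \in S -> A e -> e = 0).

(** A subspace [A] maximal among those meeting [S] only in zero is a complement: for [e] outside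
    [S + A], the span of [A] and [e] would still meet [S] trivially. *)
Lemma complement_exists : exists V : submodClosed E, complement S V.
Proof.
have [F indF totF|A [[linA dirA] maxA]] := @Zorn_bigcup E independent.
  split=> [c u v [X FX Xu] [Y FY Yv]|e Se [X FX Xe]].
    have [XY|YX] := totF X Y FX FY.
      by exists Y => //; apply: (indF Y FY).1 => //; apply: XY.
    by exists X => //; apply: (indF X FX).1 => //; apply: YX.
  exact: (indF X FX).2 Xe.
have maxP B : A `<=` B -> independent B -> B `<=` A.
  move=> AB indB; apply: contrapT => nBA.
  by apply: (maxA B) => //; split.
have A0u u : A u -> A 0 by move=> Au; rewrite -(addNr u) -scaleN1r; apply: linA.
(* The maximal [A] might a priori be empty; adjoining zero keeps it [independent], so maximality
   forces [A 0]. *)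
have A0 : A 0.
  apply: (maxP (A `|` [set 0])); [exact: subsetUl| |by right].
  split=> [c u v [Au|->] [Av|->]|e Se [|->//]]; last exact: dirA.
  - by left; apply: linA.
  - by left; apply: linA => //; apply: A0u Au.
  - by rewrite scaler0 add0r; left.
  - by rewrite scaler0 add0r; right.
pose V : {pred E} := fun e => `[< A e >].
have VE e : (e \in V) = `[< A e >] by [].
have closedV : submod_closed V.
  split=> [|c u v]; first exact/asboolP.
  by rewrite !VE => /asboolP Au /asboolP Av; apply/asboolP/linA.
pose m := GRing.isSubmodClosed.Build k E V closedV.
pose W : submodClosed E := HB.pack V m.
exists W; split=> [e|e Se /asboolP]; last exact: dirA.
pose sums x := exists (s : subsp S) (v : subsp W), x = val s + val v.
apply: contrapT => sums'e.
have sumsP s v : s \in S -> A v -> sums (s + v).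
  by move=> Ss /asboolP Av; exists (Sub s Ss), (Sub v Av).
pose B := [set x | exists c u, A u /\ x = u + c *: e].
have AB : A `<=` B by move=> u Au; exists 0, u; rewrite scale0r addr0.
have indB : independent B.
  split=> [c _ _ [a [u [Au ->]]] [b [v [Av ->]]]|x Sx [c [u [Au xE]]]].
    exists (c * a + b), (c *: u + v); split; first exact: linA.
    by rewrite scalerDr scalerA addrACA -scalerDl.
  have [c0|c_neq0] := eqVneq c 0.
    by apply: dirA => //; rewrite xE c0 scale0r addr0.
  (* With [c] nonzero, solving [x = u + c *: e] for [e] would put [e] in [S + A]. *)
  case: sums'e; have -> : e = c^-1 *: x + - c^-1 *: u.
    by rewrite xE scalerDr scalerA mulVf // scale1r scaleNr addrAC subrr add0r.
  by apply: sumsP; rewrite ?rpredZ // -[_ *: u]addr0; apply: linA.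
(* Maximality puts [e] itself in [A], so [e = 0 + e] is such a sum after all. *)
case: sums'e; rewrite -[e]add0r; apply: sumsP; first exact: rpred0.
by apply: (maxP B AB indB); exists 1, 0; rewrite scale1r add0r.
Qed.

End ComplementExistence.

Section CrossedSystemOfLeibniz.
Variables (k : fieldType) (G V : lmodType k).
Variables (brG : {bilinear G -> G -> G}) (brV : {bilinear V -> V -> V}).
Variables (tr : {bilinear V -> G -> G}) (lh : {bilinear G -> V -> G}).
Variable f : {bilinear V -> V -> G}.

Lemma crossed_system_of_leibniz :
  leibniz (crossed_product_bracket brG brV tr lh f) ->
  crossed_system brG brV tr lh f.
Proof.
move=> leib.
have L g x h y l z := leib (g, x) (h, y) (l, z).
have simp := (linear0l, linear0r, addr0, add0r, subr0).
(* [ggv] and [vvg] each serve twice: rearranged, they are CS1 and CS5; added to the identity with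
   the last two vectors swapped, they give CS6 and CS7. *)
have ggv g h x : brG g (lh h x) = lh (brG g h) x - brG (lh g x) h.
  by have [] := L g 0 h 0 0 x; rewrite /= !simp.
have vvg x y g : tr x (tr y g) = brG (f x y) g + tr (brV x y) g - lh (tr x g) y.
  by have [] := L 0 x 0 y g 0; rewrite /= !simp.
split.
- by move=> g h l; have [] := L g 0 h 0 l 0; rewrite /= !simp.
- by move=> x y z; have [] := L 0 x 0 y 0 z; rewrite /= !simp.
- by move=> g h x; rewrite ggv subrK.
- move=> g x y; have [] := L g 0 0 x 0 y; rewrite /= !simp => <-.
  by rewrite addrAC subrr add0r.
- move=> x y z; have [] := L 0 x 0 y 0 z; rewrite /= !simp => E _.
  (* The Leibniz identity has [f x (brV y z)] beside [tr x (f y z)], so this term is added to both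
     sides of CS3. *)
  apply/(addIr (f x (brV y z))); rewrite E subrK opprD.
  by rewrite addrACA !addrA addrAC.
- by move=> x g h; have [] := L 0 x g 0 h 0; rewrite /= !simp.
- by move=> x y g; rewrite vvg subrK addrAC subrr add0r.
- move=> g h x; rewrite ggv.
  have [] := L g 0 0 x h 0; rewrite /= !simp => ->.
  by rewrite addrA subrK subrr.
- move=> x y g; rewrite vvg.
  have [] := L 0 x g 0 0 y; rewrite /= !simp => ->.
  by rewrite addrA subrK subrr.
Qed.

End CrossedSystemOfLeibniz.

Section InducedBracket.
Variables (k : fieldType) (A B E W : lmodType k).
Variables (br : {bilinear E -> E -> E}).
Variables (i : {linear A -> E}) (j : {linear B -> E}) (p : {linear E -> W}).

(** One construction covers [br_V], [tr], [lh] and [f]: [i] and [j] become inclusions of summands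
    and [p] a projection onto one, so bilinearity is proved once. *)
Definition induced_bracket (a : A) (b : B) : W := p (br (i a) (j b)).

Fact induced_bracket_bilinear : bilinear_for *:%R *:%R induced_bracket.
Proof.
by split=> [b|a] c u v;
  rewrite /induced_bracket linearP ?linearPl ?linearPr linearP.
Qed.

HB.instance Definition _ :=
  bilinear_isBilinear.Build k A B W *:%R *:%R
    induced_bracket induced_bracket_bilinear.

End InducedBracket.

Section Splitting.
Variables (k : fieldType) (E : lmodType k) (S V : submodClosed E).
Variable SV : complement S V.

Definition complement_sum (a : subsp S * subsp V) : E := val a.1 + val a.2.

Fact complement_sum_linear : linear complement_sum.
Proof.
by move=> c [s v] [s1 v1]; rewrite /complement_sum /= scalerDr addrACA.
Qed.

HB.instance Definition _ :=
  GRing.isLinear.Build k (subsp S * subsp V)%type E *:%R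
    complement_sum complement_sum_linear.

Fact complement_split_subproof (e : E) : e - val (complement_proj SV e) \in S.
Proof. exact: (xchooseP (complement_ex SV e)). Qed.

Definition complement_split (e : E) : subsp S * subsp V :=
  (Sub (e - val (complement_proj SV e)) (complement_split_subproof e),
   complement_proj SV e).

Lemma complement_splitK : cancel complement_split complement_sum.
Proof. by move=> e; rewrite /complement_sum /= subrK. Qed.

Lemma complement_sumK : cancel complement_sum complement_split.
Proof.
move=> [s v]; congr (_, _); last exact: complement_projE.
by apply: val_inj; rewrite /= complement_projE addrK.
Qed.

(** The projection comes from a choice, so linearity is not visible in its formula; it is inherited
    from the inverse map [complement_sum]. *)
Fact complement_split_linear : linear complement_split.
Proof. exact: can2_linear complement_sumK complement_splitK. Qed.

HB.instance Definition _ :=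
  GRing.isLinear.Build k E (subsp S * subsp V)%type *:%R
    complement_split complement_split_linear.

End Splitting.

Theorem corollary4p1 (k : fieldType) (E : lmodType k) (g : submodClosed E)
    (br_g : {bilinear subsp g -> subsp g -> subsp g}) (leib_g : leibniz br_g)
    (br_E : {bilinear E -> E -> E}) (leib_E : leibniz br_E)
    (ext : extends_bracket br_g br_E) (ideal_g : two_sided_ideal g br_E) :
  (exists V : submodClosed E, complement g V) /\
  (forall (V : submodClosed E) (gV : complement g V),
     exists (br_V : {bilinear subsp V -> subsp V -> subsp V})
            (tr : {bilinear subsp V -> subsp g -> subsp g})
            (lh : {bilinear subsp g -> subsp V -> subsp g})
            (f : {bilinear subsp V -> subsp V -> subsp g}),
       crossed_system br_g br_V tr lh f /\
       exists phi : {linear (subsp g * subsp V)%type -> E},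
         [/\ leibniz_isomorphism
               (crossed_product_bracket br_g br_V tr lh f) br_E phi,
             stabilizes phi & costabilizes gV phi]).
Proof.
split=> [|V gV]; first exact: complement_exists.
pose psi := complement_split gV.
pose pg : {linear E -> subsp g} := fst \o psi.
pose pV : {linear E -> subsp V} := snd \o psi.
pose ig : {linear subsp g -> E} := val.
pose iV : {linear subsp V -> E} := val.
pose br_V := induced_bracket br_E iV iV pV.
pose tr := induced_bracket br_E iV ig pg.
pose lh := induced_bracket br_E ig iV pg.
pose f := induced_bracket br_E iV iV pg.
pose phi := @complement_sum _ _ g V.
have phiK : cancel phi psi := complement_sumK gV.
have psiK : cancel psi phi := complement_splitK gV.
have phi_g s : phi (s, 0) = val s by rewrite /phi /complement_sum /= addr0.
have pgK e : e \in g -> val (pg e) = e.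
  move=> ge; have /(congr1 (val \o fst)) := phiK (Sub e ge, 0).
  by rewrite phi_g.
have phiM a b : phi (crossed_product_bracket br_g br_V tr lh f a b)
    = br_E (phi a) (phi b).
  case: a b => [s v] [t w]; rewrite [RHS]linearDl !linearDr ext.
  (* The mixed brackets lie in the ideal [g], hence equal their [pg] components, [tr] and [lh]; the
     bracket of [v] and [w] splits into [f] and [br_V]. *)
  rewrite -[br_E (val v) (val t)]pgK ?(ideal_g _ _ (valP _)).2 //.
  rewrite -[br_E (val s) (val w)]pgK ?(ideal_g _ _ (valP _)).1 //.
  rewrite -[br_E (val v) (val w)]psiK /phi /complement_sum /=.
  by rewrite [RHS]addrACA !addrA.
exists br_V, tr, lh, f; split.
  (* As [phi] is injective, linear and multiplicative, the Leibniz identity of [br_E] pulls back to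
     the crossed product bracket. *)
  apply: crossed_system_of_leibniz => a b c; apply: (can_inj phiK).
  have phiB : {morph phi : x y / x - y} by apply: raddfB.
  by rewrite phiB !phiM.
exists phi; split=> //; first by split=> //; exists psi.
by move=> [s v]; apply: complement_projE.
Qed.
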